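(* Let $n,m\ge 1$, $1<p<\infty$ and $q=p/(p-1)$. Let $g_1,\dots,g_m\in\mathbb{R}^n$ be nonzero vectors and set $\hat g_i^{(p)}:=g_i/\|g_i\|_p$. Let $(v^\star,r^\star)$ be an optimal solution of $$\text{(P)}\qquad \max_{v\in\mathbb{R}^n,\;r\in\mathbb{R}}\ r\quad\text{s.t.}\quad (\hat g_i^{(p)})^\top v\ge r,\ i=1,\dots,m,\quad \|v\|_q\le 1,$$ and let $\alpha^\star$ be an optimal solution of $$\text{(D)}\qquad \min_{\alpha\in\mathbb{R}^m}\ \Bigl\|\sum_{i=1}^m\alpha_i\hat g_i^{(p)}\Bigr\|_p\quad\text{s.t.}\quad \sum_{i=1}^m\alpha_i=1,\quad \alpha_i\ge 0,\ i=1,\dots,m .$$ Define $w^\star:=\sum_{i=1}^m\alpha_i^\star\hat g_i^{(p)}$. If $r^\star>0$, then $w^\star\ne 0$ and $$v^\star=\frac{\operatorname{sgn}(w^\star)\odot|w^\star|^{p-1}}{\|w^\star\|_p^{p-1}} .$$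
   Context: $\|\cdot\|_p$ and $\|\cdot\|_q$ denote the $\ell_p$ and $\ell_q$ norms on $\mathbb{R}^n$. The operations $\operatorname{sgn}(\cdot)$, $|\cdot|$ and the power $(\cdot)^{p-1}$ are applied componentwise to vectors, and $\odot$ denotes componentwise multiplication. *)

(* Defs.v *)
From mathcomp Require Import all_boot all_order all_algebra.
From mathcomp Require Import all_classical all_reals all_analysis.

Set Implicit Arguments.
Unset Strict Implicit.
Unset Printing Implicit Defensive.

Import Order.TTheory GRing.Theory Num.Theory.
Local Open Scope ring_scope.

Section Defs.
Variable R : realType.

(* The library norm `|x| of a matrix is the sup norm, hence this definition. *)
Definition lpnorm (n : nat) (p : R) (x : 'cV[R]_n) : R :=
  (\sum_(i < n) `|x i 0| `^ p) `^ p^-1.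

Definition dotv (n : nat) (x y : 'cV[R]_n) : R := (x^T *m y) 0 0.

Definition lpnormalize (n : nat) (p : R) (x : 'cV[R]_n) : 'cV[R]_n :=
  (lpnorm p x)^-1 *: x.

Definition is_maximizer (T : Type) (feasible : T -> Prop) (f : T -> R) (x : T) :=
  feasible x /\ forall y, feasible y -> f y <= f x.

Definition is_minimizer (T : Type) (feasible : T -> Prop) (f : T -> R) (x : T) :=
  feasible x /\ forall y, feasible y -> f x <= f y.

Definition primal_feasible (n m : nat) (q : R) (h : 'I_m -> 'cV[R]_n)
    (vr : 'cV[R]_n * R) : Prop :=
  (forall i, vr.2 <= dotv (h i) vr.1) /\ lpnorm q vr.1 <= 1.

Definition primal_optimal (n m : nat) (q : R) (h : 'I_m -> 'cV[R]_n)
    (v : 'cV[R]_n) (r : R) : Prop :=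
  is_maximizer (primal_feasible q h) (fun vr => vr.2) (v, r).

Definition lincomb (n m : nat) (h : 'I_m -> 'cV[R]_n) (a : 'cV[R]_m) : 'cV[R]_n :=
  \sum_(i < m) a i 0 *: h i.

Definition dual_feasible (m : nat) (a : 'cV[R]_m) : Prop :=
  \sum_(i < m) a i 0 = 1 /\ forall i, 0 <= a i 0.

Definition dual_optimal (n m : nat) (p : R) (h : 'I_m -> 'cV[R]_n)
    (a : 'cV[R]_m) : Prop :=
  is_minimizer (@dual_feasible m) (fun b => lpnorm p (lincomb h b)) a.

(* sgn(w) (.) |w|^s, all operations componentwise. *)
Definition signed_power (n : nat) (s : R) (w : 'cV[R]_n) : 'cV[R]_n :=
  \col_i (Num.sg (w i 0) * `|w i 0| `^ s).

End Defs.

(* Main.v *)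
Require Import Defs.
From mathcomp Require Import all_boot all_order all_algebra.
From mathcomp Require Import all_classical all_reals all_analysis.
From mathcomp Require Import ring lra.

Import Order.TTheory GRing.Theory Num.Theory.
Import numFieldNormedType.Exports.
Local Open Scope ring_scope.

(* First-order optimality of [a] in (D), with [u = signed_power (p - 1) x] and
   [x = w / ||w||_p], says that [<h_i, u> >= <w, u> = ||w||_p] for all [i], so
   that [(u, ||w||_p)] is feasible in (P) and [||w||_p <= r]. Since moreover
   [r <= <w, v>], equality holds in Hoelder's inequality for [x] and [v], hence
   in Young's inequality coordinatewise, and [v = u]. Both first-order
   conditions (for (D) and for Young) come from the tangent inequality of
   [|x|^p / p] at a nearby point and the continuity of its derivative. *)

(** * Scalar signed powers and their continuity *)

Definition spow {R : realType} (s x : R) : R := Num.sg x * `|x| `^ s.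

Lemma spowN (R : realType) (s x : R) : spow s (- x) = - spow s x.
Proof. by rewrite /spow sgrN normrN mulNr. Qed.

Lemma spow0 (R : realType) (s : R) : spow s 0 = 0.
Proof. by rewrite /spow sgr0 mul0r. Qed.

Lemma spow_gt0E (R : realType) (s x : R) : 0 < x -> spow s x = x `^ s.
Proof. by move=> x0; rewrite /spow gtr0_sg// mul1r gtr0_norm. Qed.

Lemma spowMl (R : realType) (s c x : R) :
  0 < c -> spow s (c * x) = c `^ s * spow s x.
Proof.
move=> c0; rewrite /spow sgrM gtr0_sg// mul1r normrM (gtr0_norm c0).
by rewrite powRM ?normr_ge0 ?(ltW c0)// mulrCA.
Qed.

(** At [x = 0] the exponent matters: 0 to the power 0 is 1, while the sign factor makes [spow 0 0]
    vanish. *)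
Lemma normr_spow (R : realType) (s x : R) : s != 0 -> `|spow s x| = `|x| `^ s.
Proof.
move=> s0; have [->|x0] := eqVneq x 0; first by rewrite spow0 normr0 powR0.
by rewrite /spow normrM normr_sg x0 mul1r ger0_norm ?powR_ge0.
Qed.

Lemma mulr_spow (R : realType) (p x : R) :
  0 < p -> x * spow (p - 1) x = `|x| `^ p.
Proof. by move=> p0; rewrite /spow mulrA (mulrC x) -normrEsg mulr_powRB1. Qed.

(** On positive reals the power is [expR (s * ln x)]; negative reals follow by oddness, and 0 is
    handled directly. *)
Lemma spow_continuous (R : realType) (s : R) : 0 < s -> continuous (spow s).
Proof.
move=> s0.
have pos x : 0 < x -> {for x, continuous (spow s)}.
  move=> x0; rewrite /prop_for /continuous_at spow_gt0E//.
  have -> : x `^ s = expR (s * ln x) by rewrite /powR gt_eqF.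
  apply: (@cvg_trans _ (expR (s * ln t) @[t --> x]))%classic.
    apply: near_eq_cvg; near=> t.
    have t0 : 0 < t by near: t; exact: lt_nbhsr.
    by rewrite spow_gt0E// /powR gt_eqF.
  apply: (@continuous_comp _ _ _ (fun t => s * ln t) expR).
    by apply: cvgM; [exact: cvg_cst|exact: continuous_ln].
  exact: continuous_expR.
move=> x; case: (ltgtP 0 x) => [/pos//|x0|<-].
- have -> : spow s = (fun t => - spow s (- t)).
    by apply/funext => t; rewrite spowN opprK.
  apply: cvgN; apply: (@continuous_comp _ _ _ -%R (spow s)).
    exact: opp_continuous.
  by apply: pos; rewrite oppr_gt0.
- rewrite /continuous_at spow0; apply/cvgrPdist_lt => e e0; near=> t.
  rewrite sub0r normrN normr_spow ?gt_eqF//.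
  (* The radius around 0 is the [s]-th root of [e], by monotonicity of the power. *)
  have -> : e = (e `^ s^-1) `^ s by rewrite -powRrM mulVf ?gt_eqF// powRr1// ltW.
  rewrite gt0_ltr_powR ?nnegrE ?powR_ge0//.
  near: t; exact: (@nbhs0_lt _ R^o _ (powR_gt0 _ e0)).
Unshelve. all: by end_near. Qed.

(** A limit from the right preserves the sign. This replaces differentiation: a factor [t > 0] is
    divided out first, then [t] tends to 0. *)
Lemma continuous_right_ge0 (R : realType) (f : R -> R) :
  {for 0, continuous f} -> (forall t, 0 < t <= 1 -> 0 <= f t) -> 0 <= f 0.
Proof.
move=> /cvg_at_right_filter cf f0.
rewrite -(cvg_lim (@Rhausdorff R) cf); apply: limr_ge; first exact: cvgP cf.
near=> t; apply: f0; apply/andP; split.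
  by near: t; exact: nbhs_right_gt.
by near: t; apply: nbhs_right_le.
Unshelve. all: by end_near. Qed.

Lemma spow_line_continuous (R : realType) (s x d : R) :
  0 < s -> {for 0, continuous (fun t : R => spow s (x + t * d))}.
Proof.
move=> s0; apply: (@continuous_comp _ _ _ (fun t : R => x + t * d) (spow s)).
  by apply: cvgD; [exact: cvg_cst|apply: cvgM; [exact: cvg_id|exact: cvg_cst]].
exact: spow_continuous.
Qed.

(** * Conjugate exponents, Young's inequality and its equality case *)

Lemma conjugate_exponents (R : realType) (p q : R) :
  1 < p -> q = p / (p - 1) -> [/\ 0 < q, p^-1 + q^-1 = 1 & (p - 1) * q = p].
Proof.
move=> p1 ->; have p0 : 0 < p by lra.
have pp : 0 < p - 1 by lra.
split; first exact: divr_gt0.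
- by field; apply/andP; split; rewrite gt_eqF.
- by field; rewrite gt_eqF.
Qed.

Lemma normr_spow_conjugate (R : realType) (p q x : R) :
  1 < p -> q = p / (p - 1) -> `|spow (p - 1) x| `^ q = `|x| `^ p.
Proof.
move=> p1 /(conjugate_exponents _ _ _ p1)[_ _ pq].
by rewrite normr_spow -?powRrM ?pq// subr_eq0 gt_eqF.
Qed.

Lemma young (R : realType) (p q x y : R) :
  1 < p -> q = p / (p - 1) -> x * y <= `|x| `^ p / p + `|y| `^ q / q.
Proof.
move=> p1 /(conjugate_exponents _ _ _ p1)[q0 pq _].
apply: (le_trans (ler_norm _)); rewrite normrM conjugate_powR//; lra.
Qed.

(* Convexity of [|x|^p / p], whose derivative is [spow (p - 1)]: Young's
   inequality for [x] and [spow (p - 1) z]. *)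
Lemma spow_tangent (R : realType) (p x z : R) :
  1 < p -> (x - z) * spow (p - 1) z <= (`|x| `^ p - `|z| `^ p) / p.
Proof.
move=> p1; have [_ pq _] := conjugate_exponents _ _ _ p1 erefl.
have := young _ _ _ x (spow (p - 1) z) p1 erefl.
rewrite normr_spow_conjugate// mulrBl mulr_spow; last by lra.
(* With [1/q = 1 - 1/p], Young's second term cancels the product of [z] with its signed power, up to
   the term in [1/p]. *)
have -> : (p / (p - 1))^-1 = 1 - p^-1 by apply/esym/eqP; rewrite subr_eq addrC pq.
rewrite mulrBr mulr1 mulrBl; lra.
Qed.

(* In the equality case, [x] minimizes [|.|^p / p - y * .]. *)
Lemma young_eq (R : realType) (p q x y : R) :
  1 < p -> q = p / (p - 1) -> x * y = `|x| `^ p / p + `|y| `^ q / q ->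
  y = spow (p - 1) x.
Proof.
move=> p1 qE xy; have s0 : 0 < p - 1 by lra.
(* Young at [z] minus the equality at [x] bounds [(z - x) * y] by the increment of the p-th power
   over [p]; the tangent at [z] bounds that increment in turn. *)
have mono z : 0 <= (z - x) * (spow (p - 1) z - y).
  have := young _ _ _ z y p1 qE; have := spow_tangent _ _ x z p1.
  rewrite !(mulrBl, mulrBr) xy => H1 H2; lra.
(* Take [z = x + t * d], divide by [t] and let [t] tend to 0; the directions 1 and -1 then force
   equality. *)
have side d : 0 <= d * (spow (p - 1) x - y).
  have := @continuous_right_ge0 R (fun t => d * (spow (p - 1) (x + t * d) - y)).
  rewrite mul0r addr0; apply.
    apply: cvgM; first exact: cvg_cst.
    by apply: cvgB; [exact: spow_line_continuous|exact: cvg_cst].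
  move=> t /andP[t0 _]; have := mono (x + t * d).
  by rewrite addrAC subrr add0r -mulrA pmulr_rge0.
by have := side 1; have := side (-1); lra.
Qed.

(** * Dot products and p-norms of vectors *)

Lemma dotvE (R : realType) (n : nat) (x y : 'cV[R]_n) :
  dotv x y = \sum_(i < n) x i 0 * y i 0.
Proof. by rewrite /dotv mxE; apply: eq_bigr => i _; rewrite mxE. Qed.

Lemma dotvDl (R : realType) (n : nat) (x z y : 'cV[R]_n) :
  dotv (x + z) y = dotv x y + dotv z y.
Proof. by rewrite /dotv linearD mulmxDl mxE. Qed.

Lemma dotvZl (R : realType) (n : nat) (c : R) (x y : 'cV[R]_n) :
  dotv (c *: x) y = c * dotv x y.
Proof. by rewrite /dotv linearZ -scalemxAl mxE. Qed.

Lemma dotvZr (R : realType) (n : nat) (c : R) (x y : 'cV[R]_n) :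
  dotv x (c *: y) = c * dotv x y.
Proof. by rewrite /dotv -scalemxAr mxE. Qed.

Lemma dotvBl (R : realType) (n : nat) (x z y : 'cV[R]_n) :
  dotv (x - z) y = dotv x y - dotv z y.
Proof. by rewrite -scaleN1r dotvDl dotvZl mulN1r. Qed.

Lemma dotv_lincomb (R : realType) (n m : nat) (h : 'I_m -> 'cV[R]_n)
    (a : 'cV[R]_m) (y : 'cV[R]_n) :
  dotv (lincomb h a) y = \sum_(i < m) a i 0 * dotv (h i) y.
Proof.
rewrite /dotv /lincomb linear_sum mulmx_suml summxE; apply: eq_bigr => i _.
by rewrite linearZ -scalemxAl mxE.
Qed.

Lemma sumr_normr_powR_ge0 (R : realType) (n : nat) (p : R) (x : 'cV[R]_n) :
  0 <= \sum_(i < n) `|x i 0| `^ p.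
Proof. by apply: sumr_ge0 => i _; exact: powR_ge0. Qed.

Lemma lpnorm_powR (R : realType) (n : nat) (p : R) (x : 'cV[R]_n) :
  0 < p -> lpnorm p x `^ p = \sum_(i < n) `|x i 0| `^ p.
Proof.
move=> p0; rewrite /lpnorm -powRrM mulVf ?gt_eqF// powRr1//.
exact: sumr_normr_powR_ge0.
Qed.

Lemma lpnorm_le_powR (R : realType) (n : nat) (p c : R) (x : 'cV[R]_n) :
  0 < p -> lpnorm p x <= c -> \sum_(i < n) `|x i 0| `^ p <= c `^ p.
Proof.
move=> p0 xc; rewrite -lpnorm_powR// ge0_ler_powR ?nnegrE ?(ltW p0) ?powR_ge0//.
exact: le_trans (powR_ge0 _ _) xc.
Qed.

Lemma lpnorm_gt0 (R : realType) (n : nat) (p : R) (x : 'cV[R]_n) :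
  0 < p -> x != 0 -> 0 < lpnorm p x.
Proof.
move=> p0 x0; rewrite lt0r powR_ge0 andbT; apply: contraNneq x0 => N0.
have /eqP := lpnorm_powR _ _ _ x p0; rewrite N0 powR0 ?lt0r_neq0// eq_sym.
rewrite psumr_eq0 => [|i _]; last exact: powR_ge0.
move=> /allP xi0; apply/eqP/colP => i; rewrite mxE.
have /eqP/powR_eq0_eq0/normr0_eq0 := xi0 i (mem_index_enum i).
exact.
Qed.

Lemma normalized_sum_powR (R : realType) (n : nat) (p : R) (x : 'cV[R]_n) :
  0 < p -> x != 0 ->
  \sum_(i < n) `|((lpnorm p x)^-1 *: x) i 0| `^ p = 1.
Proof.
move=> p0 x0; have N0 := lpnorm_gt0 _ _ _ _ p0 x0.
under eq_bigr do rewrite mxE normrM powRM// ger0_norm ?invr_ge0 ?(ltW N0)//.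
rewrite -mulr_sumr -lpnorm_powR// -powRM ?invr_ge0 ?(ltW N0)//.
by rewrite mulVf ?gt_eqF// powR1.
Qed.

(** * Signed powers of vectors and equality in Hoelder's inequality *)

Lemma signed_powerE (R : realType) (n : nat) (s : R) (w : 'cV[R]_n) i :
  signed_power s w i 0 = spow s (w i 0).
Proof. by rewrite mxE. Qed.

Lemma signed_powerZ (R : realType) (n : nat) (s c : R) (w : 'cV[R]_n) :
  0 < c -> signed_power s (c *: w) = c `^ s *: signed_power s w.
Proof. by move=> c0; apply/colP => i; rewrite [RHS]mxE !signed_powerE mxE spowMl. Qed.

Lemma dotv_signed_power (R : realType) (n : nat) (p : R) (w : 'cV[R]_n) :
  0 < p -> dotv w (signed_power (p - 1) w) = \sum_(i < n) `|w i 0| `^ p.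
Proof.
move=> p0; rewrite dotvE; apply: eq_bigr => i _.
by rewrite signed_powerE mulr_spow.
Qed.

(** Because [(p - 1) * q = p], a vector of p-norm 1 is sent to one of q-norm 1, which meets the norm
    constraint of (P). *)
Lemma lpnorm_signed_power (R : realType) (n : nat) (p q : R) (w : 'cV[R]_n) :
  1 < p -> q = p / (p - 1) ->
  lpnorm q (signed_power (p - 1) w) = (\sum_(i < n) `|w i 0| `^ p) `^ q^-1.
Proof.
move=> p1 qE; congr (_ `^ _); apply: eq_bigr => i _.
by rewrite signed_powerE normr_spow_conjugate.
Qed.

(** The coordinatewise gaps in Young's inequality are nonnegative and sum to at most
    [1/p + 1/q - 1 = 0], so each one vanishes. *)
Lemma hoelder_eq (R : realType) (n : nat) (p q : R) (x v : 'cV[R]_n) :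
  1 < p -> q = p / (p - 1) ->
  \sum_(i < n) `|x i 0| `^ p <= 1 -> \sum_(i < n) `|v i 0| `^ q <= 1 ->
  1 <= dotv x v -> v = signed_power (p - 1) x.
Proof.
move=> p1 qE x1 v1 xv; have [q0 pq _] := conjugate_exponents _ _ _ p1 qE.
pose gap i := `|x i 0| `^ p / p + `|v i 0| `^ q / q - x i 0 * v i 0.
have gap_ge0 i : 0 <= gap i by rewrite subr_ge0; exact: young.
have gap0 : \sum_(i < n) gap i = 0.
  apply/le_anti/andP; split; last by apply: sumr_ge0.
  rewrite sumrB big_split/= -!mulr_suml -dotvE subr_le0.
  apply: le_trans xv; rewrite -pq lerD// ler_piMl// invr_ge0 ltW//; lra.
apply/colP => i; rewrite signed_powerE; apply: (young_eq _ p q) => //.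
move/eqP: gap0; rewrite psumr_eq0// => /allP/(_ i (mem_index_enum i)).
by rewrite subr_eq0 => /eqP.
Qed.

(** * First-order optimality in (D) *)

Lemma first_order_segment (R : realType) (n : nat) (p : R) (w d : 'cV[R]_n) :
  1 < p ->
  (forall t, 0 < t <= 1 ->
    \sum_(i < n) `|w i 0| `^ p <= \sum_(i < n) `|(w + t *: d) i 0| `^ p) ->
  0 <= dotv d (signed_power (p - 1) w).
Proof.
move=> p1 wmin; have p0 : 0 < p by lra.
pose f t := \sum_(i < n) d i 0 * spow (p - 1) (w i 0 + t * d i 0).
have -> : dotv d (signed_power (p - 1) w) = f 0.
  rewrite dotvE; apply: eq_bigr => i _.
  by rewrite signed_powerE mul0r addr0.
apply: continuous_right_ge0.
  apply: cvg_big => [|i _]; first exact: add_continuous.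
  apply: cvgM; first exact: cvg_cst.
  by apply: spow_line_continuous; lra.
move=> t /[dup] t01 /andP[t0 _]; rewrite -(pmulr_rge0 _ t0).
(* The tangent is taken at the moved point [w + t *: d], not at [w]: minimality of [w] then gives
   the sign of the slope [f t]. *)
have tangent_sum :
    \sum_(i < n) (w i 0 - (w + t *: d) i 0) * spow (p - 1) ((w + t *: d) i 0)
    <= \sum_(i < n) (`|w i 0| `^ p - `|(w + t *: d) i 0| `^ p) / p.
  by apply: ler_sum => i _; exact: spow_tangent.
rewrite -mulr_suml sumrB in tangent_sum.
have : \sum_(i < n) (w i 0 - (w + t *: d) i 0) * spow (p - 1) ((w + t *: d) i 0)
    <= 0.
  apply: le_trans tangent_sum _.
  by rewrite pmulr_lle0 ?invr_gt0// subr_le0; exact: wmin.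
rewrite -oppr_ge0 -sumrN /f mulr_sumr; congr (0 <= _).
apply: eq_bigr => i _; rewrite !mxE; ring.
Qed.

Lemma lincomb_segment (R : realType) (n m : nat) (h : 'I_m -> 'cV[R]_n)
    (a b : 'cV[R]_m) (t : R) :
  lincomb h (a + t *: (b - a)) =
  lincomb h a + t *: (lincomb h b - lincomb h a).
Proof.
rewrite /lincomb -sumrB scaler_sumr -big_split/=; apply: eq_bigr => i _.
by rewrite !mxE scalerDl -scalerA scalerBl.
Qed.

Lemma dual_feasible_segment (R : realType) (m : nat) (a b : 'cV[R]_m) (t : R) :
  0 <= t <= 1 -> dual_feasible a -> dual_feasible b ->
  dual_feasible (a + t *: (b - a)).
Proof.
move=> /andP[t0 t1] [a1 a0] [b1 b0]; split=> [|i].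
  under eq_bigr do rewrite !mxE.
  by rewrite big_split/= -mulr_sumr sumrB a1 b1 subrr mulr0 addr0.
rewrite !mxE.
have -> : a i 0 + t * (b i 0 - a i 0) = (1 - t) * a i 0 + t * b i 0 by ring.
by rewrite addr_ge0 ?mulr_ge0 ?subr_ge0.
Qed.

Lemma dual_feasible_delta (R : realType) (m : nat) (i : 'I_m) :
  dual_feasible (delta_mx i 0 : 'cV[R]_m).
Proof.
split=> [|j]; last by rewrite mxE ler0n.
rewrite (bigD1 i)//= big1 ?addr0 ?mxE ?eqxx// => j ji.
by rewrite mxE (negbTE ji).
Qed.

Lemma lincomb_delta (R : realType) (n m : nat) (h : 'I_m -> 'cV[R]_n) i :
  lincomb h (delta_mx i 0) = h i.
Proof.
rewrite /lincomb (bigD1 i)//= big1 ?addr0 ?mxE ?eqxx ?scale1r// => j ji.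
by rewrite mxE (negbTE ji) scale0r.
Qed.

(** The weights move from [a] towards the vertex [delta_mx i 0] of the simplex, so the combination
    moves in the direction [h i - lincomb h a]. *)
Lemma dual_optimality_condition (R : realType) (n m : nat) (p : R)
    (h : 'I_m -> 'cV[R]_n) (a : 'cV[R]_m) (i : 'I_m) :
  1 < p -> dual_optimal p h a ->
  dotv (lincomb h a) (signed_power (p - 1) (lincomb h a)) <=
  dotv (h i) (signed_power (p - 1) (lincomb h a)).
Proof.
move=> p1 [fa amin]; have p0 : 0 < p by lra.
rewrite -subr_ge0 -dotvBl; apply: first_order_segment => // t /andP[t0 t1].
rewrite -[X in _ <= X](lpnorm_powR _ _ _ _ p0).
apply: (lpnorm_le_powR _ _ _ _ _ p0).
rewrite -(lincomb_delta _ _ _ h i) -lincomb_segment; apply: amin.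
apply: dual_feasible_segment => //; last exact: dual_feasible_delta.
by rewrite (ltW t0).
Qed.

(** * Weak duality and the formula for the primal solution *)

(** Average the constraints of (P) with the weights [a], which sum to 1. *)
Lemma primal_dual_weak (R : realType) (n m : nat) (q r : R)
    (h : 'I_m -> 'cV[R]_n) (v : 'cV[R]_n) (a : 'cV[R]_m) :
  primal_feasible q h (v, r) -> dual_feasible a -> r <= dotv (lincomb h a) v.
Proof.
move=> [/= rv _] [a1 a0]; rewrite dotv_lincomb -[r]mul1r -a1 mulr_suml.
by apply: ler_sum => i _; exact: ler_wpM2l.
Qed.

Theorem proposition3p3 (R : realType) (n m : nat) (p q : R)
    (g : 'I_m -> 'cV[R]_n) (v : 'cV[R]_n) (r : R) (a : 'cV[R]_m) :
  (1 <= n)%N -> (1 <= m)%N ->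
  1 < p -> q = p / (p - 1) ->
  (forall i, g i != 0) ->
  let ghat := fun i => lpnormalize p (g i) in
  primal_optimal q ghat v r ->
  dual_optimal p ghat a ->
  let w := lincomb ghat a in
  0 < r ->
  w != 0 /\
  v = (lpnorm p w `^ (p - 1))^-1 *: signed_power (p - 1) w.
Proof.
move=> _ _ p1 qE _ ghat [fv vmax] aopt w r0; have p0 : 0 < p by lra.
have [q0 _ _] := conjugate_exponents _ _ _ p1 qE.
have rw : r <= dotv w v by apply: primal_dual_weak fv _; case: aopt.
have w0 : w != 0.
  (* If [w] were 0, the bound [rw] would read [r <= 0]. *)
  apply: contraTneq rw => ->; rewrite -ltNge -(scale0r 0) dotvZl mul0r//.
split=> //; set N := lpnorm p w.
have N0 : 0 < N by exact: lpnorm_gt0.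
pose x := N^-1 *: w.
have x1 : \sum_(i < n) `|x i 0| `^ p = 1 by exact: normalized_sum_powR.
have uE : signed_power (p - 1) x =
    (N `^ (p - 1))^-1 *: signed_power (p - 1) w.
  rewrite signed_powerZ ?invr_gt0//; congr (_ *: _).
  by rewrite -(powR_inv1 (ltW N0)) powRAC powR_inv1 ?powR_ge0.
rewrite -uE; apply: (hoelder_eq _ _ p q) => //; first by rewrite x1.
  by have := lpnorm_le_powR _ _ _ _ _ q0 fv.2; rewrite powR1.
(* The optimality condition for [w], rescaled by a positive constant so that its left side becomes
   [N]. *)
have uN i : N <= dotv (ghat i) (signed_power (p - 1) x).
  have wu : dotv w (signed_power (p - 1) x) = N.
    have -> : w = N *: x by rewrite scalerA mulfV ?gt_eqF// scale1r.
    by rewrite dotvZl dotv_signed_power// x1 mulr1.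
  have Nc0 : 0 < (N `^ (p - 1))^-1 by rewrite invr_gt0 powR_gt0.
  by rewrite -wu uE !dotvZr ler_pM2l//; exact: dual_optimality_condition.
have Nr : N <= r.
  apply: (vmax (signed_power (p - 1) x, N)); split; first exact: uN.
  by rewrite (lpnorm_signed_power _ _ _ _ _ p1 qE) x1 powR1.
(* After multiplication by [N], the goal is [N <= r <= dotv w v]. *)
by rewrite dotvZl mulrC ler_pdivlMr// mul1r (le_trans Nr).
Qed.
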